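(* Fix $\beta>0$. There exists a constant $C(\beta)>0$ depending only on $\beta$ such that, for every Erlang-C model with arrival rate $\lambda>0$, service rate $\mu>0$ and $n$ servers satisfying $n=R+\beta\sqrt{R}$, where $R=\lambda/\mu$, $$\big|\mathbb{E}W-\mathbb{E}Y_0\big|\ \ge\ \frac{C(\beta)}{\sqrt{R}}.$$
   Context: Erlang-C ($M/M/n$) model: $\lambda,\mu>0$, $n$ is a positive integer, $R=\lambda/\mu<n$, $\delta=1/\sqrt{R}$, $\beta=\delta(n-R)>0$ (so $n=R+\beta\sqrt R$). $X=\{X(t),t\ge 0\}$ is the birth-death continuous-time Markov chain on $\{0,1,2,\dots\}$ with birth rate $\lambda$ and death rate $\mu\min(k,n)$ in state $k$; it is positive recurrent. $W$ is a random variable having the stationary distribution of $\delta(X(t)-R)$. Let $b(x)=-\min(\mu x,\mu\beta)$ for $x\in\mathbb{R}$. $Y_0$ is a random variable on $\mathbb{R}$ with density $\frac{\kappa}{\mu}\exp\big(\int_0^x \frac{b(y)}{\mu}\,dy\big)$, where $\kappa>0$ is the normalizing constant. *)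

(* Defs.v *)
From HB Require Import structures.
From mathcomp Require Import all_boot all_order all_algebra.
From mathcomp Require Import all_classical all_reals all_analysis.
Set Implicit Arguments.
Unset Strict Implicit.
Unset Printing Implicit Defensive.
Import Order.TTheory GRing.Theory Num.Theory.
Import numFieldNormedType.Exports.
Local Open Scope classical_set_scope.
Local Open Scope ring_scope.

(* [Pt t i j] is the probability of moving from [i] to [j] in time [t]; its
   values at negative times are irrelevant. *)
Record transition_function (R : realType) (Pt : R -> nat -> nat -> R) : Prop :=
  TransitionFunction {
    tf_ge0 : forall (t : R) i j, 0 <= t -> 0 <= Pt t i j ;
    tf_mass : forall (t : R) i, 0 <= t ->
      (\sum_(0 <= j <oo) (Pt t i j)%:E = 1)%E ;
    tf_id : forall i j, Pt 0 i j = (i == j)%:R ;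
    tf_chapman_kolmogorov : forall (s t : R) i j, 0 <= s -> 0 <= t ->
      ((Pt (s + t) i j)%:E
         = \sum_(0 <= k <oo) (Pt s i k * Pt t k j)%:E)%E }.

Definition has_rates (R : realType) (Pt : R -> nat -> nat -> R)
    (Q : nat -> nat -> R) : Prop :=
  forall i j, (Pt h i j - (i == j)%:R) / h @[h --> 0^'+] --> Q i j.

(* The initial law is arbitrary. Only the times [t 0 < ... < t m.+1] matter;
   they are given as the first terms of an infinite increasing sequence. The
   Markov property is written in product form, which avoids conditioning on
   null events. *)
Definition markov_process (R : realType) (Pt : R -> nat -> nat -> R)
    (d : measure_display) (T : measurableType d) (P : probability T R)
    (X : R -> {RV P >-> nat}) : Prop :=
  forall (m : nat) (t : nat -> R) (i : nat -> nat),
    0 <= t 0 -> (forall k, t k < t k.+1) ->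
    (P [set w | forall k, (k <= m.+1)%N -> X (t k) w = i k]
     = P [set w | forall k, (k <= m)%N -> X (t k) w = i k]
       * (Pt (t m.+1 - t m)%R (i m) (i m.+1))%:E)%E.

Definition stationary (R : realType) (Pt : R -> nat -> nat -> R)
    (pi : probability nat R) : Prop :=
  forall (t : R) j, 0 <= t ->
    (\sum_(0 <= i <oo) (pi [set i] * (Pt t i j)%:E) = pi [set j])%E.

Definition birth_death_rates (R : realType) (birth death : nat -> R)
    (i j : nat) : R :=
  if j == i.+1 then birth i
  else if i == j.+1 then death i
  else if i == j then - (birth i + (if i is 0 then 0 else death i))
  else 0.

Definition erlangC_rates (R : realType) (lambda mu : R) (n : nat) :
    nat -> nat -> R :=
  birth_death_rates (fun=> lambda) (fun k => mu * (minn k n)%:R).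

Definition erlangC_chain (R : realType) (lambda mu : R) (n : nat)
    (Pt : R -> nat -> nat -> R)
    (d : measure_display) (T : measurableType d) (P : probability T R)
    (X : R -> {RV P >-> nat}) : Prop :=
  [/\ transition_function Pt, has_rates Pt (erlangC_rates lambda mu n)
    & markov_process Pt X].

Definition scaled_state (R : realType) (r : R) (k : nat) : R :=
  (Num.sqrt r)^-1 * (k%:R - r).

Definition has_law (R : realType) (d : measure_display) (T : measurableType d)
    (P : probability T R) (Y : {RV P >-> R}) (nu : set R -> \bar R) : Prop :=
  forall A : set R, measurable A -> distribution P Y A = nu A.

Definition drift (R : realType) (mu beta x : R) : R :=
  - Num.min (mu * x) (mu * beta).

(* The signed integral of [f] from 0 to [x], also for negative [x]. *)
Definition integral_from0 (R : realType) (f : R -> R) (x : R) : R :=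
  if 0 <= x then \int[@lebesgue_measure R]_(y in `[0, x]) f y
  else - \int[@lebesgue_measure R]_(y in `[x, 0]) f y.

Definition diffusion_density (R : realType) (mu beta kappa x : R) : R :=
  kappa / mu * expR (integral_from0 (fun y => drift mu beta y / mu) x).

Definition normalizing_constant (R : realType) (mu beta kappa : R) : Prop :=
  0 < kappa /\
  (\int[@lebesgue_measure R]_x (diffusion_density mu beta kappa x)%:E = 1)%E.

(* Main.v *)
Require Import Defs.
From HB Require Import structures.
From mathcomp Require Import all_boot all_order all_algebra.
From mathcomp Require Import all_classical all_reals all_analysis.
From mathcomp Require Import measurable_realfun ring lra.
Import Order.TTheory GRing.Theory Num.Theory.
Import numFieldNormedType.Exports.
Local Open Scope classical_set_scope.
Local Open Scope ring_scope.

(* Write [r = lambda / mu], [s = sqrt r], [n = m + 1] and [a = exp (- beta^2 / 2)].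
   Stationarity forces detailed balance, which gives
     [E W = 1 / (beta^2 (S / s + 1 / beta))],  [S = sum_(j <= m) m! / (m - j)! r^(-j)],
   while integrating the density gives
     [E Y0 = 1 / (beta^2 (B / a + 1 / beta))],  [B = int_(-oo)^beta exp (- x^2 / 2) dx].
   With [w = beta - x] one has [B / a = int_0^oo exp (beta w - w^2 / 2) dw], and the
   substitution [1 + u = exp (w / s)] in [S = r int_0^oo exp (- r u) (1 + u)^m du] gives
     [S / s = int_0^oo exp (n w / s - r (exp (w / s) - 1)) dw],
   whose integrand is at most [exp (beta w - w^2 / 2 - w^3 / (6 s))] since
   [n = r + beta s] and [exp y >= 1 + y + y^2 / 2 + y^3 / 6]. Hence [B / a - S / s] is
   positive and at least of order [1 / s]; the lower bound on [s] needed for uniformity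
   comes from [n >= 1]. *)

(** * Detailed balance *)

Lemma sum_le_nneseries (R : realType) (u : nat -> R) (l : R) (N : nat) :
  (forall k, 0 <= u k) -> (\sum_(0 <= k <oo) (u k)%:E = l%:E)%E ->
  \sum_(0 <= k < N) u k <= l.
Proof.
move=> u0 ul; rewrite -lee_fin -ul -sumEFin.
by apply: nneseries_lim_ge => k _ _; rewrite lee_fin.
Qed.

Lemma nneseries_cvg (R : realType) (u : nat -> R) (l : R) :
  (forall k, 0 <= u k) -> (\sum_(0 <= k <oo) (u k)%:E = l%:E)%E ->
  series u @ \oo --> l.
Proof.
move=> u0 ul.
have cu : cvgn (fun N => (\sum_(0 <= k < N) (u k)%:E)%E).
  by apply: is_cvg_nneseries => k _ _; rewrite lee_fin.
have /fine_cvg := cvg_toP cu ul.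
by rewrite (_ : fine \o _ = series u)//; apply/funext => N /=; rewrite sumEFin.
Qed.

Lemma ge0_integral_nat (R : realType) (m : {measure set nat -> \bar R})
    (f : nat -> \bar R) : (forall k, 0 <= f k)%E ->
  (\int[m]_k f k = \sum_(0 <= k <oo) f k * m [set k])%E.
Proof.
move=> f0.
have <- : \bigcup_(k in [set: nat]) [set k] = [set: nat].
  by rewrite (bigcup_imset1 _ id) image_id.
rewrite ge0_integral_bigcup//=.
- apply: eq_eseriesr => k _.
  rewrite (eq_integral (cst (f k))) ?integral_cst//.
  by move=> j; rewrite inE/= => ->.
- by move=> i j _ _ [x []] /= -> ->.
Qed.

Lemma probability_nat_series (R : realType) (pi : probability nat R) :
  series (fun k => fine (pi [set k])) @ \oo --> (1 : R).
Proof.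
apply: nneseries_cvg => [k|]; first exact: fine_ge0.
rewrite -(probability_setT pi) -[RHS]mul1e -integral_cst// ge0_integral_nat//.
by apply: eq_eseriesr => k _; rewrite mul1e fineK// fin_num_measure.
Qed.

Section stationary_distribution.
Context {R : realType} {Pt : R -> nat -> nat -> R} {Q : nat -> nat -> R}
  (pi : probability nat R).
Hypotheses (tf : transition_function Pt) (rates : has_rates Pt Q)
  (pi_st : stationary Pt pi).

Let p (k : nat) : R := fine (pi [set k]).

Lemma probability_set1E (k : nat) : pi [set k] = (p k)%:E.
Proof. by rewrite fineK// fin_num_measure. Qed.

Lemma stationary_le (N j : nat) (t : R) : 0 <= t ->
  \sum_(0 <= i < N) p i * Pt t i j <= p j.
Proof.
move=> t0; apply: sum_le_nneseries => [k|].
  by rewrite mulr_ge0 ?fine_ge0 ?(tf_ge0 tf).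
rewrite -probability_set1E -(pi_st _ j t0).
by apply: eq_eseriesr => i _; rewrite probability_set1E EFinM.
Qed.

(* Keeping only finitely many terms of the stationarity equation avoids any
   interchange of the sum with the derivative at time 0. *)
Lemma stationary_rates_le0 (N j : nat) : (j < N)%N ->
  \sum_(0 <= i < N) p i * Q i j <= 0.
Proof.
move=> jN.
have cv : \sum_(0 <= i < N) p i * ((Pt h i j - (i == j)%:R) / h) @[h --> 0^'+]
    --> \sum_(0 <= i < N) p i * Q i j.
  apply: cvg_big => [|i _]; first exact: add_continuous.
  by apply: cvgMl_tmp; exact: rates.
apply: (cvgr_to_le cv).
near=> h.
have h0 : 0 < h by near: h; exact: nbhs_right_gt.
under eq_bigr do rewrite mulrA.
rewrite -mulr_suml pmulr_lle0 ?invr_gt0//.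
under eq_bigr do rewrite mulrBr.
rewrite big_split/= sumrN subr_le0.
(* Since [j < N], the Kronecker terms sum to exactly [p j], so the numerator of the quotient is at
   most 0 for every [h > 0]. *)
rewrite [leRHS](_ : _ = p j); first exact/stationary_le/ltW.
rewrite big_mkord (bigD1 (Ordinal jN))//= eqxx mulr1 big1 ?addr0// => i.
by rewrite -val_eqE/= => /negPf ->; rewrite mulr0.
Unshelve. all: by end_near. Qed.

Lemma stationary_cvg0 : p @ \oo --> (0 : R).
Proof.
apply: cvg_series_cvg_0; apply/cvg_ex; exists 1.
exact: probability_nat_series.
Qed.

Variables (lambda mu : R) (n : nat).
Hypothesis QE : Q = erlangC_rates lambda mu n.

Lemma erlangC_detailed_balance (k : nat) : 0 <= mu ->
  lambda * p k = mu * (minn k.+1 n)%:R * p k.+1.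
Proof.
move=> mu0.
pose flux j := lambda * p j - mu * (minn j.+1 n)%:R * p j.+1.
(* The balance inequalities say that the flux from [j] to [j.+1] is nonnegative
   and nondecreasing in [j]; it tends to 0, so it vanishes. *)
have flux0 : 0 <= flux 0%N.
  have := @stationary_rates_le0 2 0 isT.
  rewrite !big_nat_recr//= big_geq// add0r QE /erlangC_rates /birth_death_rates/=.
  rewrite /flux; lra.
have fluxS j : flux j <= flux j.+1.
  (* Column [j.+1] of the generator vanishes outside rows [j], [j.+1], [j.+2], so truncation at
     [j.+3] loses nothing and the inequality reads [flux j - flux j.+1 <= 0]. *)
  have := @stationary_rates_le0 j.+3 j.+1 (leqnSn _).
  rewrite !big_nat_recr//= big_nat big1 ?add0r => [|i /andP[_ ij]]; last first.
    have e1 : (j.+1 == i.+1) = false by rewrite eqSS gtn_eqF.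
    have e2 : (i == j.+2) = false by rewrite ltn_eqF// !ltnS ltnW// ltnW.
    have e3 : (i == j.+1) = false by rewrite ltn_eqF// ltnS ltnW.
    by rewrite QE /erlangC_rates /birth_death_rates e1 e2 e3 mulr0.
  have e1 : (j.+1 == j.+3) = false by rewrite ltn_eqF.
  have e2 : (j == j.+2) = false by rewrite ltn_eqF.
  have e3 : (j == j.+1) = false by rewrite ltn_eqF.
  have e4 : (j.+1 == j.+2) = false by rewrite ltn_eqF.
  rewrite QE /erlangC_rates /birth_death_rates !eqxx e1 e4 /flux.
  move: (mu * (minn j.+1 n)%:R) (mu * (minn j.+2 n)%:R) => x y.
  lra.
have flux_le j i : flux j <= flux (i + j)%N.
  by elim: i => // i IH; exact: (le_trans IH).
have flux_le0 j : flux j <= 0.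
  have cv : (fun i => lambda * p (i + j)) @ \oo --> (0 : R).
    rewrite -(mulr0 lambda); apply: cvgMl_tmp.
    by rewrite (cvg_shiftn j); exact: stationary_cvg0.
  (* Dropping the death term gives [flux j <= flux (i + j) <= lambda * p (i + j)], and the right
     side tends to 0. *)
  apply: (cvgr_to_ge cv); apply: nearW => i.
  apply: (le_trans (flux_le j i)); rewrite gerBl !mulr_ge0//.
  exact: fine_ge0.
have flux_ge0 j : 0 <= flux j.
  by rewrite (le_trans flux0)//; have := flux_le 0%N j; rewrite addn0.
by apply/eqP; rewrite -subr_eq0 eq_le flux_le0 flux_ge0.
Qed.

End stationary_distribution.

(** * Mass and mean of the birth-death stationary law *)

(* [sum_(j <= m) m! / (m - j)! r^(-j)], the inverse of Erlang's B formula. *)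
Fixpoint erlang_sum {R : realType} (r : R) (m : nat) : R :=
  if m is k.+1 then 1 + k.+1%:R / r * erlang_sum r k else 1.

Lemma erlang_sum_ge0 (R : realType) (r : R) (m : nat) :
  0 <= r -> 0 <= erlang_sum r m.
Proof. by move=> r0; elim: m => //= m IH; rewrite addr_ge0 ?mulr_ge0 ?invr_ge0. Qed.

Section erlangC_mean.
Context {R : realType} (r : R) (m : nat) (p : nat -> R).
Hypotheses (r_gt0 : 0 < r) (r_lt : r < m.+1%:R) (p_ge0 : forall k, 0 <= p k)
  (p_balance : forall k, r * p k = (minn k.+1 m.+1)%:R * p k.+1)
  (p_sum : series p @ \oo --> (1 : R)).

(** From [m] on, the weights are geometric with ratio [r / (m + 1)]; the mass strictly above [m] is
    therefore [a * p m]. *)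
Let a := r / (m.+1%:R - r).

(** Up to [m] the balance reads [p k = (k + 1) / r * p (k + 1)], which is the recursion defining
    [erlang_sum]. *)
Lemma mass_below (k : nat) : (k <= m)%N ->
  \sum_(0 <= i < k.+1) p i = p k * erlang_sum r k.
Proof.
elim: k => [|k IH] km; first by rewrite big_nat1 mulr1.
have e := p_balance k; rewrite (minn_idPl _) in e; last exact: leqW.
rewrite big_nat_recr//= IH ?(ltnW km)//.
have -> : p k = k.+1%:R / r * p k.+1.
  by apply: (mulfI (lt0r_neq0 r_gt0)); rewrite e; field; exact: lt0r_neq0.
by ring.
Qed.

(** The sum telescopes: balance gives [i * p i = r * p (i - 1)], so each term with [i > 0] is
    [r * (p (i - 1) - p i)]. *)
Lemma mean_below (k : nat) : (k <= m)%N ->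
  \sum_(0 <= i < k.+1) (i%:R - r) * p i = - r * p k.
Proof.
elim: k => [|k IH] km; first by rewrite big_nat1 sub0r.
have e := p_balance k; rewrite (minn_idPl _) in e; last exact: leqW.
by rewrite big_nat_recr//= IH ?(ltnW km)// mulNr e; ring.
Qed.

Let balance_above j : r * p (m + j) = m.+1%:R * p (m + j).+1.
Proof. by rewrite p_balance (minn_idPr _)// ltnS leq_addr. Qed.

Let mr0 : m.+1%:R - r != 0 :> R. Proof. by rewrite subr_eq0 gt_eqF. Qed.

Lemma mass_above (j : nat) : \sum_(0 <= i < m.+1 + j) p i =
  p m * erlang_sum r m + a * (p m - p (m + j)).
Proof.
elim: j => [|j IH]; first by rewrite !addn0 subrr mulr0 addr0 mass_below.
rewrite addnS big_nat_recr//= IH addnS addSn.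
have -> : p (m + j) = m.+1%:R / r * p (m + j).+1.
  by apply: (mulfI (lt0r_neq0 r_gt0)); rewrite balance_above; field; exact: lt0r_neq0.
rewrite /a; field; rewrite nat1r mr0 lt0r_neq0//.
Qed.

Lemma mean_above (j : nat) : \sum_(0 <= i < m.+1 + j) (i%:R - r) * p i =
  a ^+ 2 * p m - (a * j%:R + r + a ^+ 2) * p (m + j).
Proof.
elim: j => [|j IH]; first by rewrite !addn0 mean_below//; ring.
rewrite addnS big_nat_recr//= IH addnS addSn.
have -> : p (m + j) = m.+1%:R / r * p (m + j).+1.
  by apply: (mulfI (lt0r_neq0 r_gt0)); rewrite balance_above; field; exact: lt0r_neq0.
rewrite -!addSn natrD /a; field; rewrite nat1r mr0 lt0r_neq0//.
Qed.

Let p_cvg0 : (fun j => p (m + j)) @ \oo --> (0 : R).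
Proof.
rewrite (_ : (fun _ => _) = (fun j => p (j + m))); last first.
  by apply/funext => j; rewrite addnC.
rewrite (cvg_shiftn m); apply: cvg_series_cvg_0.
by apply/cvg_ex; exists 1.
Qed.

Lemma mass_total : p m * (erlang_sum r m + a) = 1.
Proof.
suff cv : series p @ \oo --> p m * (erlang_sum r m + a).
  by rewrite -(cvg_lim (@Rhausdorff R) cv) (cvg_lim (@Rhausdorff R) p_sum).
rewrite -(cvg_shiftn m.+1).
rewrite [X in X @ _ --> _](_ : _ =
    (fun j => p m * erlang_sum r m + a * (p m - p (m + j)))); last first.
  by apply/funext => j /=; rewrite -mass_above (addnC j).
suff : (fun j => p m * erlang_sum r m + a * (p m - p (m + j))) @ \oo
    --> p m * erlang_sum r m + a * (p m - 0).
  by rewrite subr0 mulrDr [p m * a]mulrC.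
by apply: cvgD; [exact: cvg_cst|apply: cvgMl_tmp; apply: cvgB => //; exact: cvg_cst].
Qed.

Let w (i : nat) : R := (i%:R - r) * p i.

(** The remainder in [mean_above] contains [j * p (m + j)], which does not vanish merely because [p]
    does. Beyond [m] the terms are nonnegative and the partial sums are at most [a ^+ 2 * p m], so
    the series converges and its terms tend to 0; this controls the remainder. *)
Lemma mean_total : series w @ \oo --> a ^+ 2 * p m.
Proof.
have w_ge0 i : (m < i)%N -> 0 <= w i.
  move=> mi; rewrite mulr_ge0// subr_ge0 ltW// (lt_le_trans r_lt)//.
  by rewrite ler_nat.
have a_gt0 : 0 < a by rewrite divr_gt0// subr_gt0.
have cvw : cvgn (series w).
  suff /cvg_ex[l] : cvgn [sequence series w (j + m.+1)%N]_j.
    by rewrite cvg_shiftn => cvl; apply/cvg_ex; exists l.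
  apply: nondecreasing_is_cvgn.
    apply/nondecreasing_seqP => j /=; rewrite addSn /series/= big_nat_recr//= lerDl.
    by rewrite w_ge0// addnS ltnS leq_addl.
  exists (a ^+ 2 * p m) => _ [i _ <-] /=; rewrite addnC /series/= mean_above.
  have [a_ge0 r_ge0] := (ltW a_gt0, ltW r_gt0).
  rewrite gerBl; apply: mulr_ge0 => //; apply: addr_ge0.
    by apply: addr_ge0 => //; apply: mulr_ge0.
  exact: exprn_ge0.
have w_cvg0 : (fun j => w (m + j)) @ \oo --> (0 : R).
  rewrite (_ : (fun _ => _) = (fun j => w (j + m))); last first.
    by apply/funext => j; rewrite addnC.
  rewrite (cvg_shiftn m); exact: cvg_series_cvg_0.
rewrite -(cvg_shiftn m.+1).
(* The factor [a * j] is rewritten as [a * (m + j - r) - a * (m - r)], so that only [w (m + j)] and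
   [p (m + j)] remain, both tending to 0. *)
rewrite [X in X @ _ --> _](_ : _ = (fun j => a ^+ 2 * p m
    - (a * w (m + j) + (r + a ^+ 2 - a * (m%:R - r)) * p (m + j)))); last first.
  apply/funext => j /=; rewrite (addnC j) /series/= mean_above /w natrD; ring.
suff : (fun j => a ^+ 2 * p m
    - (a * w (m + j) + (r + a ^+ 2 - a * (m%:R - r)) * p (m + j))) @ \oo
    --> a ^+ 2 * p m - (a * 0 + (r + a ^+ 2 - a * (m%:R - r)) * 0).
  by rewrite !mulr0 addr0 subr0.
by apply: cvgB; [exact: cvg_cst|apply: cvgD; exact: cvgMl_tmp].
Qed.

End erlangC_mean.

(** * Expectations from laws *)

Lemma cvg_nneseries (R : realType) (u : nat -> R) (l : R) :
  series u @ \oo --> l -> (\sum_(0 <= k <oo) (u k)%:E = l%:E)%E.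
Proof.
move=> ul; apply/cvg_lim => //.
rewrite (_ : (fun _ => _) = EFin \o series u); last first.
  by apply/funext => N /=; rewrite -sumEFin.
by apply: cvg_EFin; [exact: nearW|].
Qed.

(** Only finitely many terms can be negative, so the negative part has a finite sum and the positive
    part sums to [l] plus that; their difference is then meaningful in the extended reals. *)
Lemma integral_nat_eventually_ge0 (R : realType) (pi : probability nat R)
    (f : nat -> R) (N : nat) (l : R) :
  (forall k, (N <= k)%N -> 0 <= f k) ->
  series (fun k => f k * fine (pi [set k])) @ \oo --> l ->
  (\int[pi]_k (f k)%:E = l%:E)%E.
Proof.
move=> f_ge0 fl; set p := (X in series (fun k => _ * X k)) in fl.
pose q (g : R -> R) k := g (f k) * p k.
pose pos x : R := Num.max x 0; pose neg x : R := Num.max (- x) 0.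
have intE (g : R -> R) c : (forall x, 0 <= g x) -> series (q g) @ \oo --> c ->
    (\int[pi]_k (g (f k))%:E = c%:E)%E.
  move=> g0 gc; rewrite ge0_integral_nat => [|k]; last by rewrite lee_fin.
  rewrite -(cvg_nneseries _ _ _ gc); apply: eq_eseriesr => k _.
  by rewrite EFinM fineK// fin_num_measure.
have pos_ge0 x : 0 <= pos x by rewrite le_max lexx orbT.
have neg_ge0 x : 0 <= neg x by rewrite le_max lexx orbT.
have negc : series (q neg) @ \oo --> series (q neg) N.
  rewrite -(cvg_shiftn N); apply: cvg_near_cst; apply: nearW => k /=.
  elim: k => // k <-; rewrite addSn /series/= big_nat_recr//= /q /neg.
  by rewrite (max_idPr _) ?mul0r ?addr0// oppr_le0 f_ge0// leq_addl.
have posc : series (q pos) @ \oo --> l + series (q neg) N.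
  rewrite (_ : series _ = series (fun k => f k * p k) + series (q neg)).
    exact: cvgD.
  apply/funext => k; rewrite /series/= -[RHS]big_split/=; apply: eq_bigr => i _.
  rewrite /q -mulrDl /pos /neg; congr (_ * _).
  by rewrite !maxEle oppr_le0; case: (lerP (f i) 0); case: (lerP 0 (f i)); lra.
rewrite integralE.
under eq_integral do rewrite funeposE/= -EFin_max.
under [X in (_ - X)%E]eq_integral do rewrite funenegE/= -EFin_max.
rewrite (intE pos _ pos_ge0 posc) (intE neg _ neg_ge0 negc).
by rewrite -EFinB addrK.
Qed.

(** Equal laws give equal integrals of nonnegative functions; this is applied to the positive and
    negative parts separately. *)
Lemma expectation_has_law (R : realType) (d d' : measure_display)
    (T : measurableType d) (T' : measurableType d') (P : probability T R)
    (m : {measure set T' -> \bar R}) (s : T' -> R) (W : {RV P >-> R}) :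
  measurable_fun [set: T'] s -> has_law W (pushforward m s) ->
  ('E_P[W] = \int[m]_x (s x)%:E)%E.
Proof.
move=> ms lawW; rewrite expectation_def.
have E (f : R -> \bar R) : measurable_fun setT f -> (forall x, 0 <= f x)%E ->
    (\int[P]_w f (W w) = \int[m]_x f (s x))%E.
  move=> mf f0.
  rewrite -(ge0_integral_pushforward ms m measurableT)//.
  rewrite -(ge0_integral_pushforward (measurable_funPT W) P measurableT)//.
  by apply: eq_measure_integral => A mA _; exact: lawW.
rewrite [LHS]integralE [RHS]integralE.
congr (_ - _)%E.
  under eq_integral do rewrite funeposE.
  under [RHS]eq_integral do rewrite funeposE.
  apply: (E (fun x => maxe x%:E 0%E)) => [|x]; last by rewrite le_max lexx orbT.
  by apply: measurable_maxe => //; exact/measurable_EFinP.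
under eq_integral do rewrite funenegE.
under [RHS]eq_integral do rewrite funenegE.
apply: (E (fun x => maxe (- x%:E) 0)%E) => [|x]; last by rewrite le_max lexx orbT.
by apply: measurable_maxe => //; apply: measurableT_comp => //; exact/measurable_EFinP.
Qed.

(** The density [g] and the Radon-Nikodym derivative of [nu] have the same integral over every
    measurable set, hence agree almost everywhere. *)
Lemma ge0_integral_density (d : measure_display) (T : measurableType d)
    (R : realType) (nu : {finite_measure set T -> \bar R})
    (m : {sigma_finite_measure set T -> \bar R}) (g : T -> R) (f : T -> \bar R) :
  measurable_fun [set: T] g ->
  (forall A, measurable A -> nu A = \int[m]_(x in A) (g x)%:E)%E ->
  measurable_fun [set: T] f -> (forall x, 0 <= f x)%E ->
  (\int[nu]_x f x = \int[m]_x (f x * (g x)%:E))%E.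
Proof.
move=> mg nuE mf f0.
have numu : nu `<< m.
  apply/null_content_dominatesP => A mA A0; rewrite nuE//.
  by apply: null_set_integral => //; exact/measurable_funTS/measurable_EFinP.
rewrite -(Radon_Nikodym_SigmaFinite.change_of_variables numu)//.
have iRN := Radon_Nikodym_SigmaFinite.f_integrable numu.
apply: ae_eq_integral => //.
- by apply: emeasurable_funM => //; exact: measurable_int iRN.
- by apply: emeasurable_funM => //; exact/measurable_EFinP.
suff : ae_eq m setT (Radon_Nikodym_SigmaFinite.f nu m) (EFin \o g).
  by apply: filterS => x /= gx _; rewrite gx.
apply: integral_ae_eq => //; first exact/measurable_EFinP.
by move=> A _ mA; rewrite -Radon_Nikodym_SigmaFinite.f_integral// nuE.
Qed.

Lemma expectation_density (R : realType) (d : measure_display)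
    (T : measurableType d) (P : probability T R) (Y : {RV P >-> R})
    (g : R -> R) (f : R -> \bar R) : measurable_fun setT g ->
  has_law Y (fun A => \int[lebesgue_measure]_(x in A) (g x)%:E)%E ->
  measurable_fun setT f -> (forall x, 0 <= f x)%E ->
  (\int[P]_w f (Y w) = \int[lebesgue_measure]_x (f x * (g x)%:E))%E.
Proof.
move=> mg lawY mf f0.
(* [lebesgue_measure] lives on [measurableTypeR R], whose measurable sets are
   those of [R] but under a different display. *)
have mY : measurable_fun setT (Y : T -> measurableTypeR R) := measurable_funPT Y.
pose Y' : {mfun T >-> measurableTypeR R} :=
  HB.pack (Y : T -> measurableTypeR R) (isMeasurableFun.Build _ _ _ _ _ mY).
pose nu : probability (measurableTypeR R) R := distribution P Y'.
rewrite -(@ge0_integral_density _ _ _ nu (@lebesgue_measure R) g f mg lawY mf f0).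
by rewrite (ge0_integral_pushforward mY P measurableT mf).
Qed.

(** * Explicit integrals *)

(** One term of the exponential series, [(c x)^(m+1) / (m+1)! <= exp (c x)], bounds the product by
    [k / x]. *)
Lemma cvg_exprn_expRN (R : realType) (m : nat) (c : R) : 0 < c ->
  x ^+ m * expR (- (c * x)) @[x --> +oo] --> (0 : R).
Proof.
move=> c0; pose k : R := m.+1`!%:R / c ^+ m.+1.
have lim : k * x^-1 @[x --> +oo] --> (0 : R).
  rewrite -(mulr0 k); apply: cvgMl_tmp.
  apply/(@gtr0_cvgV0 _ _ _ _ id); last exact: cvg_id.
  by apply: nbhs_pinfty_gt; rewrite num_real.
apply: (squeeze_cvgr _ (cvg_cst 0) lim); near=> x.
have x0 : 0 < x by near: x; exact: nbhs_pinfty_gt.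
apply/andP; split; first by rewrite mulr_ge0 ?expR_ge0// exprn_ge0// ltW.
rewrite expRN ler_pdivrMr ?expR_gt0//.
have le_exp : (c * x) ^+ m.+1 / m.+1`!%:R <= expR (c * x).
  by apply: le_trans (expR_ge1Dxn _ _); rewrite ?ler_wpDl// mulr_ge0// ltW.
apply: le_trans (ler_wpM2l _ le_exp); last first.
  by rewrite !mulr_ge0 ?invr_ge0 ?exprn_ge0// ltW.
rewrite le_eqVlt; apply/orP; left; apply/eqP.
rewrite /k exprMn [x ^+ m.+1]exprS; field.
by rewrite !lt0r_neq0 ?exprn_gt0// ltr0n fact_gt0.
Unshelve. all: by end_near. Qed.

Lemma cvg_expR_quadratic (R : realType) (b : R) :
  expR (b * x - x ^+ 2 / 2) @[x --> +oo] --> (0 : R).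
Proof.
have lim : expR ((b + 1) ^+ 2 / 2) * expR (- x) @[x --> +oo] --> (0 : R).
  by rewrite -(mulr0 (expR ((b + 1) ^+ 2 / 2))); apply: cvgMl_tmp; exact: cvgr_expR.
apply: (squeeze_cvgr _ (cvg_cst 0) lim); apply: nearW => x.
rewrite expR_ge0/= -expRD ler_expR.
by have := sqr_ge0 (x - (b + 1)); lra.
Qed.

(** The cubic term kept here is the source of the [1 / s] gap between the two integrals. *)
Lemma expR_ge_cubic (R : realType) (x : R) : 0 <= x ->
  1 + x + x ^+ 2 / 2 + x ^+ 3 / 6 <= expR x.
Proof.
move=> x0.
have -> : 1 + x + x ^+ 2 / 2 + x ^+ 3 / 6 = series (exp_coeff x) 4.
  rewrite /series/= !big_nat_recr//= big_geq// /exp_coeff/= !factS fact0.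
  by rewrite expr0 expr1; field.
apply: nondecreasing_cvgn_le; last exact: is_cvg_series_exp_coeff.
by apply: nondecreasing_series => k _ _; exact: exp_coeff_ge0.
Qed.

Lemma integral_FTC (R : realType) (f F : R -> R) (a b : R) : a <= b ->
  continuous f -> (forall x : R, is_derive x (1 : R) F (f x)) ->
  (\int[lebesgue_measure]_(x in `[a, b]) (f x)%:E = (F b - F a)%:E)%E.
Proof.
rewrite le_eqVlt => /predU1P[<- _ _|ab cf dF].
  by rewrite set_itv1 integral_set1 subrr.
have cF : continuous F.
  by move=> x; apply: differentiable_continuous; apply/derivable1_diffP; case: (dF x).
rewrite (@continuous_FTC2 _ _ F) => //.
- exact: continuous_subspaceT.
- split => [x _||].
  + by case: (dF x).
  + by apply/cvg_at_right_filter/cF.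
  + by apply/cvg_at_left_filter/cF.
- by move=> x _; rewrite derive1E; case: (dF x).
Qed.

Lemma ge0_integral_FTCy (R : realType) (f F : R -> R) (a l : R) :
  (forall x, a <= x -> 0 <= f x) -> continuous f ->
  (forall x : R, is_derive x (1 : R) F (f x)) -> F x @[x --> +oo] --> l ->
  (\int[lebesgue_measure]_(x in `[a, +oo[) (f x)%:E = (l - F a)%:E)%E.
Proof.
move=> f0 cf dF Fl.
have cF : continuous F.
  by move=> x; apply: differentiable_continuous; apply/derivable1_diffP; case: (dF x).
rewrite EFinB; apply: ge0_continuous_FTC2y => //.
- exact: continuous_subspaceT.
- by apply/cvg_at_right_filter/cF.
- by move=> x _; rewrite derive1E; case: (dF x).
Qed.

Lemma Rintegral_affine (R : realType) (f : R -> R) (c d a b : R) : a <= b ->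
  {in `[a, b], forall x, f x = c * x + d} ->
  \int[lebesgue_measure]_(y in `[a, b]) f y =
  c * (b ^+ 2 - a ^+ 2) / 2 + d * (b - a).
Proof.
move=> ab fE.
have -> : \int[lebesgue_measure]_(y in `[a, b]) f y =
    \int[lebesgue_measure]_(y in `[a, b]) (c * y + d).
  by apply: eq_Rintegral => x /[!inE]; exact: fE.
pose F (x : R) : R := c * (x * x) / 2 + d * x.
suff FTC : (\int[lebesgue_measure]_(y in `[a, b]) (c * y + d)%:E = (F b - F a)%:E)%E.
  by rewrite /Rintegral FTC/= /F; field.
apply: integral_FTC => // x.
  by apply: cvgD; [apply: cvgMl_tmp; exact: cvg_id|exact: cvg_cst].
by apply: is_derive_eq; rewrite /GRing.scale/=; field.
Qed.

(** The antiderivative of [- min (x, beta)] that vanishes at 0; [mu] cancels in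
    [drift mu beta y / mu]. *)
Definition drift_potential {R : realType} (beta x : R) : R :=
  if x <= beta then - (x ^+ 2 / 2) else beta ^+ 2 / 2 - beta * x.

Lemma integral_from0_drift (R : realType) (mu beta x : R) : 0 < mu -> 0 < beta ->
  integral_from0 (fun y => drift mu beta y / mu) x = drift_potential beta x.
Proof.
move=> mu0 beta0; rewrite /integral_from0 /drift_potential.
have driftE y : drift mu beta y / mu = - Num.min y beta.
  rewrite /drift -minr_pMr ?ltW// mulNr [mu * _]mulrC mulfK// lt0r_neq0//.
(* No sign is imposed on [a], so this serves both [[x, 0]] with [x < 0] and the part of [[0, x]]
   below [beta]. *)
have below a b : a <= b -> b <= beta ->
    \int[lebesgue_measure]_(y in `[a, b]) (drift mu beta y / mu) =
    (a ^+ 2 - b ^+ 2) / 2.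
  move=> ab bb; rewrite (@Rintegral_affine _ _ (-1) 0 _ _ ab).
    by field.
  move=> y; rewrite in_itv/= => /andP[_ yb].
  by rewrite driftE min_l ?(le_trans yb)//; ring.
case: ifPn => [x0|]; last first.
  rewrite -ltNge => x0; rewrite (below _ _ (ltW x0) (ltW beta0)) ifT; first by field.
  by rewrite ltW// (lt_trans x0).
case: ifPn => [xb|]; first by rewrite below//; field.
rewrite -ltNge => xb.
have ii : lebesgue_measure.-integrable `[0, x]
    (EFin \o (fun y => drift mu beta y / mu)).
  apply: continuous_compact_integrable; first exact: segment_compact.
  apply: continuous_subspaceT => y.
  rewrite (_ : (fun _ => _) = (fun y => - Num.min y beta)); last first.
    by apply/funext => z; rewrite driftE.
  by apply: cvgN; apply: continuous_min; [exact: cvg_id|exact: cvg_cst].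
have := @Rintegral_itvB _ _ _ _ beta ii; rewrite !bnd_simp !ltW// => /(_ isT isT).
rewrite Rintegral_itv_obnd_cbnd; last first.
  apply: integrableS ii => //.
  by apply: subset_itvr; rewrite bnd_simp ltW.
rewrite (below _ _ (ltW beta0) (lexx _)) (@Rintegral_affine _ _ 0 (- beta) _ _ (ltW xb)).
  by move/eqP; rewrite subr_eq => /eqP ->; field.
move=> y; rewrite in_itv/= => /andP[by_ _].
by rewrite driftE min_r//; ring.
Qed.

(** The two pieces share only the null point [b]. The left end is an interval bound so that it can
    be minus infinity. *)
Lemma ge0_integral_split (R : realType) (f : R -> R) (a : itv_bound R) (b : R) :
  (a <= BLeft b)%O -> continuous f -> (forall x, 0 <= f x) ->
  (\int[lebesgue_measure]_(x in [set` Interval a +oo%O]) (f x)%:E =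
   \int[lebesgue_measure]_(x in [set` Interval a (BRight b)]) (f x)%:E +
   \int[lebesgue_measure]_(x in `[b, +oo[) (f x)%:E)%E.
Proof.
move=> ab cf f0.
have mf (D : set R) : measurable_fun D (EFin \o f).
  by apply: measurable_funTS; apply/measurable_EFinP; exact: continuous_measurable_fun.
rewrite -(@integral_itv_obnd_cbnd _ b); last exact: mf.
rewrite -ge0_integral_setU//=; last first.
- apply/disj_setPRL => x /=; rewrite !in_itv/= => /andP[bx _].
  by apply/negP; rewrite negb_and -ltNge bx orbT.
- by move=> x _; rewrite lee_fin.
- exact: mf.
rewrite -itv_bndbnd_setU//.
by apply: le_trans ab _; rewrite bnd_simp.
Qed.

(** A form without case distinction, from which continuity at [beta] is immediate. *)
Lemma drift_potentialE (R : realType) (beta x : R) :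
  drift_potential beta x = Num.max (x - beta) 0 ^+ 2 / 2 - x ^+ 2 / 2.
Proof.
rewrite /drift_potential; case: ifPn => [xb|].
  by rewrite max_r ?subr_le0//; field.
by rewrite -ltNge => xb; rewrite max_l ?subr_ge0 1?ltW//; field.
Qed.

Lemma continuous_sqr (R : realType) : continuous (fun x : R => x ^+ 2).
Proof. exact: exprn_continuous. Qed.

Lemma continuous_expR_comp (R : realType) (g : R -> R) :
  continuous g -> continuous (fun x => expR (g x)).
Proof.
by move=> cg x; apply: (@continuous_comp _ _ _ g expR);
  [exact: cg|exact: continuous_expR].
Qed.

Lemma continuous_expR_drift_potential (R : realType) (beta : R) :
  continuous (fun x => expR (drift_potential beta x)).
Proof.
apply: continuous_expR_comp => x.
rewrite (_ : drift_potential beta =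
    fun x => Num.max (x - beta) 0 ^+ 2 / 2 - x ^+ 2 / 2); last first.
  by apply/funext => y; exact: drift_potentialE.
apply: cvgB; apply: cvgMr_tmp; last exact: continuous_sqr.
apply: (@continuous_comp _ _ _ (fun y => Num.max (y - beta) 0)
    (fun z => z ^+ 2)); last exact: continuous_sqr.
apply: continuous_max; last exact: cvg_cst.
by apply: cvgB; [exact: cvg_id|exact: cvg_cst].
Qed.

(** Lets instance resolution differentiate exponentials, so that each antiderivative below reduces
    to a [field] identity. *)
#[local] Instance is_derive_expR_comp (R : realType) (g : R -> R) (x b : R) :
  is_derive x (1 : R) g b ->
  is_derive x (1 : R) (fun y => expR (g y)) (b * expR (g x)).
Proof.
move=> dg; rewrite mulrC.
exact: (@is_derive1_comp _ expR g x (expR (g x)) b (is_derive_expR _) dg).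
Qed.

(** * Integrals against the unnormalized diffusion density *)

Section limit_integrals.
Context {R : realType} (beta : R).
Hypothesis beta_gt0 : 0 < beta.

Let a := expR (- (beta ^+ 2 / 2)).
Let V := drift_potential beta.
Let leb := @lebesgue_measure R.

(** The two branches of [exp V], each extended smoothly to the whole line so that the
    antiderivatives hold everywhere. *)
Let g0 (x : R) := expR (- (x ^+ 2 / 2)).
Let g1 (x : R) := expR (beta ^+ 2 / 2 - beta * x).

Let continuous_g0 : continuous g0.
Proof.
apply: continuous_expR_comp => x.
by apply: cvgN; apply: cvgMr_tmp; exact: continuous_sqr.
Qed.

Let continuous_g1 : continuous g1.
Proof.
apply: continuous_expR_comp => x.
by apply: cvgB; [exact: cvg_cst|apply: cvgMl_tmp; exact: cvg_id].
Qed.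

Let V_below x : x <= beta -> expR (V x) = g0 x.
Proof. by move=> xb; rewrite /V /drift_potential xb. Qed.

Let V_above x : beta <= x -> expR (V x) = g1 x.
Proof.
rewrite /V /drift_potential /g1; case: ifPn => // xb bx.
have -> : x = beta by apply: le_anti; rewrite bx xb.
by congr expR; field.
Qed.

Let g1_beta : g1 beta = a.
Proof. by rewrite /g1 /a; congr expR; field. Qed.

Let is_derive_g0 (x : R) : is_derive x (1 : R) (fun y => - g0 y) (x * g0 x).
Proof. by apply: is_derive_eq; rewrite /GRing.scale/= /g0; field. Qed.

Let is_derive_g1 (x : R) : is_derive x (1 : R) (fun y => - (g1 y / beta)) (g1 x).
Proof. by apply: is_derive_eq; rewrite /GRing.scale/= /g1; field; exact: lt0r_neq0. Qed.

Let is_derive_xg1 (x : R) :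
  is_derive x (1 : R) (fun y => - ((y / beta + (beta ^+ 2)^-1) * g1 y)) (x * g1 x).
Proof. by apply: is_derive_eq; rewrite /GRing.scale/= /g1; field; exact: lt0r_neq0. Qed.

Let g1_cvg0 m : x ^+ m * g1 x @[x --> +oo] --> (0 : R).
Proof.
rewrite (_ : (fun _ => _) = fun x =>
    expR (beta ^+ 2 / 2) * (x ^+ m * expR (- (beta * x)))); last first.
  by apply/funext => x; rewrite /g1 expRD mulrCA.
by rewrite -(mulr0 (expR (beta ^+ 2 / 2))); apply: cvgMl_tmp; exact: cvg_exprn_expRN.
Qed.

Let g0_cvg0 : g0 x @[x --> +oo] --> (0 : R).
Proof.
rewrite (_ : g0 = fun x => expR (0 * x - x ^+ 2 / 2)); first exact: cvg_expR_quadratic.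
by apply/funext => x; rewrite mul0r sub0r.
Qed.

Lemma integral_exp_tail :
  (\int[leb]_(x in `[beta, +oo[) (expR (V x))%:E = (a / beta)%:E)%E.
Proof.
transitivity (\int[leb]_(x in `[beta, +oo[) (g1 x)%:E)%E.
  by apply: eq_integral => x /[!inE]/=; rewrite in_itv/= andbT => /V_above ->.
rewrite (_ : a / beta = 0 - - (g1 beta / beta)); last first.
  by rewrite sub0r opprK g1_beta.
apply: (@ge0_integral_FTCy _ g1 (fun y => - (g1 y / beta))) => //.
- by move=> x _; exact: expR_ge0.
- rewrite -oppr0 -(mul0r beta^-1); apply: cvgN; apply: cvgMr_tmp.
  by have := g1_cvg0 0; under eq_fun do rewrite expr0 mul1r.
Qed.

Lemma integral_x_exp_tail :
  (\int[leb]_(x in `[beta, +oo[) (x * expR (V x))%:E =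
   (a + a / beta ^+ 2)%:E)%E.
Proof.
transitivity (\int[leb]_(x in `[beta, +oo[) (x * g1 x)%:E)%E.
  by apply: eq_integral => x /[!inE]/=; rewrite in_itv/= andbT => /V_above ->.
rewrite (_ : a + _ = 0 - - ((beta / beta + (beta ^+ 2)^-1) * g1 beta)); last first.
  by rewrite sub0r opprK g1_beta; field; exact: lt0r_neq0.
apply: (@ge0_integral_FTCy _ _ (fun y => - ((y / beta + (beta ^+ 2)^-1) * g1 y))) => //.
- by move=> x bx; rewrite mulr_ge0 ?expR_ge0// (le_trans (ltW beta_gt0)).
- by move=> x; apply: cvgM; [exact: cvg_id|exact: continuous_g1].
- have lim : beta^-1 * (x ^+ 1 * g1 x) + (beta ^+ 2)^-1 * (x ^+ 0 * g1 x) @[x --> +oo] -->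
      beta^-1 * 0 + (beta ^+ 2)^-1 * 0.
    by apply: cvgD; apply: cvgMl_tmp; exact: g1_cvg0.
  rewrite -oppr0; apply: cvgN; move: lim; rewrite !mulr0 addr0.
  by under eq_fun do rewrite expr1 expr0 mul1r mulrA -mulrDl (mulrC beta^-1).
Qed.

Lemma integral_x_gauss :
  (\int[leb]_(x in `[0%R, beta]) (x * expR (V x))%:E = (1 - a)%:E)%E.
Proof.
transitivity (\int[leb]_(x in `[0%R, beta]) (x * g0 x)%:E)%E.
  by apply: eq_integral => x /[!inE]/=; rewrite in_itv/= => /andP[_ /V_below ->].
rewrite (_ : 1 - a = - g0 beta - - g0 0); last first.
  by rewrite /g0 expr0n/= mul0r oppr0 expR0 opprK addrC.
apply: (@integral_FTC _ _ (fun y => - g0 y)); [exact: ltW| |by []].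
by move=> x; apply: cvgM; [exact: cvg_id|exact: continuous_g0].
Qed.

Lemma integral_x_gaussy :
  (\int[leb]_(x in `[0%R, +oo[) (x * g0 x)%:E = 1%:E)%E.
Proof.
rewrite (_ : 1 = 0 - - g0 0); last first.
  by rewrite /g0 expr0n/= mul0r oppr0 expR0 opprK add0r.
apply: (@ge0_integral_FTCy _ _ (fun y => - g0 y)) => //.
- by move=> x x0; rewrite mulr_ge0// expR_ge0.
- by move=> x; apply: cvgM; [exact: cvg_id|exact: continuous_g0].
- by rewrite -oppr0; apply: cvgN; exact: g0_cvg0.
Qed.

End limit_integrals.

(** * Mean of the diffusion limit *)

Section diffusion_mean.
Context {R : realType} (beta : R).
Hypothesis beta_gt0 : 0 < beta.

Let a := expR (- (beta ^+ 2 / 2)).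
Let V := drift_potential beta.
Let leb := @lebesgue_measure R.

(** Kept as an extended real: its finiteness is deduced later from the normalization of the
    density. *)
Definition gauss_left (beta : R) : \bar R :=
  (\int[lebesgue_measure]_(x in `]-oo, beta]) (expR (- (x ^+ 2 / 2)))%:E)%E.

Lemma integral_expR_potential :
  (\int[leb]_x (expR (V x))%:E = gauss_left beta + (a / beta)%:E)%E.
Proof.
rewrite -set_itvNyy (@ge0_integral_split _ _ _ beta)//; last first.
  exact: continuous_expR_drift_potential.
rewrite integral_exp_tail//; congr (_ + _)%E.
apply: eq_integral => x /[!inE]/=; rewrite in_itv/= => xb.
by rewrite /V /drift_potential xb.
Qed.

Let continuous_pos : continuous (fun x : R => Num.max x 0 * expR (V x)).
Proof.
move=> x; apply: cvgM; last exact: continuous_expR_drift_potential.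
by apply: continuous_max; [exact: cvg_id|exact: cvg_cst].
Qed.

Let continuous_neg : continuous (fun x : R => Num.max (- x) 0 * expR (V x)).
Proof.
move=> x; apply: cvgM; last exact: continuous_expR_drift_potential.
apply: continuous_max; last exact: cvg_cst.
by apply: cvgN; exact: cvg_id.
Qed.

Let max0_ge0 (x : R) : 0 <= Num.max x 0.
Proof. by rewrite le_max lexx orbT. Qed.

(** The half-line below 0 contributes nothing, [[0, beta]] contributes [1 - a], and the tail
    [a + a / beta ^+ 2]. *)
Lemma integral_pos_part :
  (\int[leb]_x (Num.max x 0 * expR (V x))%:E = (1 + a / beta ^+ 2)%:E)%E.
Proof.
have pos_ge0 x : 0 <= Num.max x 0 * expR (V x) by rewrite mulr_ge0 ?expR_ge0.
rewrite -set_itvNyy (@ge0_integral_split _ _ _ 0)//.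
rewrite integral0_eq ?add0e; last first.
  by move=> x/=; rewrite in_itv/= => x0; rewrite max_r// mul0r.
rewrite (@ge0_integral_split _ _ _ beta) ?bnd_simp ?ltW//.
rewrite [X in (X + _)%E](_ : _ = (1 - a)%:E); last first.
  rewrite -(integral_x_gauss _ beta_gt0); apply: eq_integral => x /[!inE]/=.
  by rewrite in_itv/= => /andP[x0 _]; rewrite max_l.
rewrite [X in (_ + X)%E](_ : _ = (a + a / beta ^+ 2)%:E); last first.
  rewrite -(integral_x_exp_tail _ beta_gt0); apply: eq_integral => x /[!inE]/=.
  by rewrite in_itv/= andbT => bx; rewrite max_l// (le_trans (ltW beta_gt0)).
by rewrite -EFinD; congr _%:E; ring.
Qed.

(** Reflection turns this into [integral_x_gaussy]. The value 1 cancels the 1 of the positive part,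
    leaving [a / beta ^+ 2] for the mean. *)
Lemma integral_neg_part :
  (\int[leb]_x (Num.max (- x) 0 * expR (V x))%:E = 1%:E)%E.
Proof.
have neg_ge0 x : 0 <= Num.max (- x) 0 * expR (V x) by rewrite mulr_ge0 ?expR_ge0.
rewrite -set_itvNyy (@ge0_integral_split _ _ _ 0)//.
rewrite [X in (_ + X)%E]integral0_eq ?adde0; last first.
  by move=> x/=; rewrite in_itv/= andbT => x0; rewrite max_r ?oppr_le0// mul0r.
rewrite -{1}oppr0 ge0_integration_by_substitutionNy//; last first.
  exact: continuous_subspaceT.
rewrite -integral_x_gaussy; apply: eq_integral => x /[!inE]/=.
rewrite in_itv/= andbT => x0; rewrite opprK max_l// /V /drift_potential ifT.
  by rewrite sqrrN.
by rewrite (le_trans _ (ltW beta_gt0))// oppr_le0.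
Qed.

End diffusion_mean.

Lemma expectation_diffusion (R : realType) (mu beta kappa : R)
    (d : measure_display) (T : measurableType d) (P : probability T R)
    (Y : {RV P >-> R}) : 0 < mu -> 0 < beta -> 0 <= kappa ->
  has_law Y (fun A => \int[lebesgue_measure]_(x in A)
    (diffusion_density mu beta kappa x)%:E)%E ->
  ('E_P[Y] = (kappa / mu * (expR (- (beta ^+ 2 / 2)) / beta ^+ 2))%:E)%E.
Proof.
move=> mu0 beta0 kappa0 lawY; pose V := drift_potential beta.
have densE x : diffusion_density mu beta kappa x = kappa / mu * expR (V x).
  by rewrite /diffusion_density integral_from0_drift.
have mdens : measurable_fun setT (diffusion_density mu beta kappa).
  rewrite (_ : diffusion_density _ _ _ =
      fun x => kappa / mu * expR (V x)); last exact/funext.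
  apply: measurable_funM => //; apply: continuous_measurable_fun.
  exact: continuous_expR_drift_potential.
(* Used with [s] the identity and with [s] the negation, for the two parts of [Y]. *)
have E (s : R -> R) (l : R) : continuous s ->
    (\int[lebesgue_measure]_x (Num.max (s x) 0 * expR (V x))%:E = l%:E)%E ->
    (\int[P]_w (maxe (s (Y w))%:E 0) = (kappa / mu * l)%:E)%E.
  move=> cs sl.
  rewrite (expectation_density _ _ _ _ _ _
      (fun x => maxe (s x)%:E 0%E) mdens lawY); last 2 first.
  - apply: measurable_maxe => //; apply/measurable_EFinP.
    exact: continuous_measurable_fun.
  - by move=> x; rewrite le_max lexx orbT.
  rewrite EFinM -sl -ge0_integralZl_EFin ?divr_ge0 ?(ltW mu0)//; last 2 first.
  - move=> x _; rewrite lee_fin mulr_ge0 ?expR_ge0//.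
    by rewrite le_max lexx orbT.
  - apply/measurable_EFinP/measurable_funM.
      by apply: measurable_maxr => //; exact: continuous_measurable_fun.
    by apply: continuous_measurable_fun; exact: continuous_expR_drift_potential.
  apply: eq_integral => x _; rewrite densE -EFin_max -!EFinM; congr _%:E; ring.
rewrite expectation_def integralE.
under eq_integral do rewrite funeposE.
under [X in (_ - X)%E]eq_integral do rewrite funenegE -EFinN.
rewrite (E id _ _ (integral_pos_part _ beta0)); last by move=> x; exact: cvg_id.
rewrite (E -%R _ _ (integral_neg_part _ beta0)); last first.
  by move=> x; apply: cvgN; exact: cvg_id.
by rewrite -EFinB; congr _%:E; ring.
Qed.

(** * Comparison of the Erlang and Gaussian integrals *)

Lemma cvg_addr_pinfty (R : realType) (b : R) : y + b @[y --> +oo] --> +oo.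
Proof.
apply/cvgryPge => M; near=> y; rewrite -lerBlDr.
by near: y; apply: nbhs_pinfty_ge; rewrite num_real.
Unshelve. all: by end_near. Qed.

Section erlang_integral.
Context {R : realType} (s : R).
Hypothesis s_gt0 : 0 < s.

(** This is [(1 + u)^k exp (- r u)] with [r = s^2] and [1 + u = exp (w / s)]. *)
Definition erlang_kernel (k : nat) (w : R) : R :=
  expR (k%:R / s * w - s ^+ 2 * (expR (w / s) - 1)).

(** The integral of [erlang_kernel k.+1] over [[w, +oo[], in the closed form produced by repeated
    integration by parts. *)
Fixpoint erlang_tail (k : nat) (w : R) : R :=
  if k is k'.+1 then erlang_kernel k w / s + k%:R / s ^+ 2 * erlang_tail k' w
  else erlang_kernel k w / s.

Lemma continuous_erlang_kernel (k : nat) : continuous (erlang_kernel k).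
Proof.
apply: continuous_expR_comp => w; apply: cvgB.
  by apply: cvgMl_tmp; exact: cvg_id.
apply: cvgMl_tmp; apply: cvgB; last exact: cvg_cst.
apply: (continuous_expR_comp _ (fun z => z / s)) => z.
by apply: cvgMr_tmp; exact: cvg_id.
Qed.

Lemma erlang_kernelS (k : nat) (w : R) :
  erlang_kernel k.+1 w = expR (w / s) * erlang_kernel k w.
Proof. by rewrite /erlang_kernel -expRD -natr1; congr expR; field; exact: lt0r_neq0. Qed.

Lemma is_derive_erlang_kernel (k : nat) (w : R) :
  is_derive w (1 : R) (erlang_kernel k)
    (k%:R / s * erlang_kernel k w - s * erlang_kernel k.+1 w).
Proof.
rewrite erlang_kernelS; apply: is_derive_eq.
by rewrite /erlang_kernel /GRing.scale/=; field; exact: lt0r_neq0.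
Qed.

(** Differentiating the kernel of index [k] yields the kernels of indices [k] and [k.+1]; the former
    is cancelled by the recursive term. *)
Lemma is_derive_erlang_tail (k : nat) (w : R) :
  is_derive w (1 : R) (erlang_tail k) (- erlang_kernel k.+1 w).
Proof.
have dG := is_derive_erlang_kernel.
elim: k => [|k IH] /=.
  by apply: is_derive_eq; rewrite /GRing.scale/=; field; exact: lt0r_neq0.
by apply: is_derive_eq; rewrite /GRing.scale/=; field; exact: lt0r_neq0.
Qed.

(** All kernels equal 1 at 0, so the recursion of [erlang_tail] becomes that of [erlang_sum],
    divided by [s]. *)
Lemma erlang_tail0 (k : nat) : erlang_tail k 0 = erlang_sum (s ^+ 2) k / s.
Proof.
have G0 j : erlang_kernel j 0 = 1.
  by rewrite /erlang_kernel mulr0 mul0r expR0 subrr mulr0 subr0 expR0.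
by elim: k => [|k IH] /=; rewrite G0 ?IH//; field; exact: lt0r_neq0.
Qed.

Lemma cvg_erlang_kernel (k : nat) : erlang_kernel k w @[w --> +oo] --> (0 : R).
Proof.
apply: (squeeze_cvgr _ (cvg_cst 0) (cvg_expR_quadratic _ (k%:R / s - s))).
near=> w.
have w0 : 0 <= w by near: w; apply: nbhs_pinfty_ge; rewrite num_real.
rewrite /erlang_kernel expR_ge0/= ler_expR.
have ws0 : 0 <= w / s by rewrite divr_ge0// ltW.
have := expR_ge_cubic _ _ ws0.
have : 0 <= (w / s) ^+ 3 / 6 by rewrite divr_ge0// exprn_ge0.
move=> c0 /(le_trans _) c1.
have {c1} : 1 + w / s + (w / s) ^+ 2 / 2 <= expR (w / s) by apply: c1; rewrite lerDl.
rewrite -(ler_pM2l (exprn_gt0 2 s_gt0)).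
have -> : s ^+ 2 * (1 + w / s + (w / s) ^+ 2 / 2) = s ^+ 2 + s * w + w ^+ 2 / 2.
  by field; exact: lt0r_neq0.
lra.
Unshelve. all: by end_near. Qed.

Lemma cvg_erlang_tail (k : nat) : erlang_tail k w @[w --> +oo] --> (0 : R).
Proof.
elim: k => [|k IH] /=.
  by rewrite -(mul0r s^-1); apply: cvgMr_tmp; exact: cvg_erlang_kernel.
suff : erlang_kernel k.+1 w / s + k.+1%:R / s ^+ 2 * erlang_tail k w
    @[w --> +oo] --> 0 / s + k.+1%:R / s ^+ 2 * 0 by rewrite mul0r mulr0 addr0.
by apply: cvgD; [apply: cvgMr_tmp; exact: cvg_erlang_kernel|exact: cvgMl_tmp].
Qed.

(** The shift by [b], later [beta], places the kernel on the half-line where it is compared with the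
    Gaussian. *)
Lemma integral_erlang_kernel (k : nat) (b : R) :
  (\int[lebesgue_measure]_(y in `[(- b)%R, +oo[) (erlang_kernel k.+1 (y + b))%:E
   = (erlang_sum (s ^+ 2) k / s)%:E)%E.
Proof.
rewrite -erlang_tail0 (_ : erlang_tail k 0 = 0 - - erlang_tail k (- b + b)); last first.
  by rewrite addNr sub0r opprK.
apply: (@ge0_integral_FTCy _ _ (fun y => - erlang_tail k (y + b))).
- by move=> y _; exact: expR_ge0.
- move=> y; apply: (@continuous_comp _ _ _ (fun y => y + b) (erlang_kernel k.+1)).
    by apply: cvgD; [exact: cvg_id|exact: cvg_cst].
  exact: continuous_erlang_kernel.
- move=> y; rewrite -[erlang_kernel _ _]opprK; apply: is_deriveN.
  rewrite -[- _]mulr1.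
  apply: (@is_derive1_comp _ (erlang_tail k) (fun y => y + b)).
    exact: is_derive_erlang_tail.
  by apply: is_derive_eq; rewrite addr0.
- rewrite -oppr0; apply: cvgN.
  exact: (cvg_comp _ _ (cvg_addr_pinfty _ b) (cvg_erlang_tail k)).
Qed.

End erlang_integral.

(** * Pointwise and integrated gap between the Gaussian and the Erlang kernel *)

Section kernel_comparison.
Context {R : realType} (beta s : R) (m : nat).
Hypotheses (beta_gt0 : 0 < beta) (s_gt0 : 0 < s)
  (mE : m.+1%:R = s ^+ 2 + beta * s).

Let a := expR (- (beta ^+ 2 / 2)).
Let phi (y : R) := expR (- (y ^+ 2 / 2)).
(** The factor [a] completes the square: with [w = y + beta], [a * exp (beta w - w^2 / 2)] is
    [phi y]. *)
Let G (y : R) := a * erlang_kernel s m.+1 (y + beta).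

(** By [mE] the linear terms in [s * w] cancel, and the cubic bound on [exp (w / s)] leaves the
    Gaussian exponent minus [w^3 / (6 s)]. *)
Lemma erlang_kernel_le (y : R) : - beta <= y ->
  G y <= phi y * expR (- ((y + beta) ^+ 3 / (6 * s))).
Proof.
move=> yb; rewrite /G /a /phi /erlang_kernel -!expRD ler_expR.
set w := y + beta; have yE : y = w - beta by rewrite /w addrK.
have w0 : 0 <= w by rewrite /w -lerBlDr sub0r.
have ws0 : 0 <= w / s by rewrite divr_ge0// ltW.
have := expR_ge_cubic _ _ ws0; rewrite -(ler_pM2l (exprn_gt0 2 s_gt0)).
have -> : s ^+ 2 * (1 + w / s + (w / s) ^+ 2 / 2 + (w / s) ^+ 3 / 6) =
    s ^+ 2 + s * w + w ^+ 2 / 2 + w ^+ 3 / (6 * s).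
  by field; exact: lt0r_neq0.
have -> : m.+1%:R / s * w = s * w + beta * w by rewrite mE; field; exact: lt0r_neq0.
move: (w ^+ 3 / _) (expR _) => t e; rewrite yE; lra.
Qed.

Lemma continuous_gauss : continuous phi.
Proof.
by apply: continuous_expR_comp => x; apply: cvgN; apply: cvgMr_tmp; exact: continuous_sqr.
Qed.

Lemma continuous_scaled_kernel : continuous G.
Proof.
move=> y; apply: cvgMl_tmp.
apply: (@continuous_comp _ _ _ (fun y => y + beta) (erlang_kernel s m.+1)).
  by apply: cvgD; [exact: cvg_id|exact: cvg_cst].
exact: continuous_erlang_kernel.
Qed.

Lemma scaled_kernel_le_gauss (y : R) : - beta <= y -> G y <= phi y.
Proof.
move=> yb; have w0 : 0 <= y + beta by rewrite -lerBlDr sub0r.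
have s6 : 0 <= 6 * s by rewrite mulr_ge0// ltW.
apply: le_trans (erlang_kernel_le _ yb) _.
by rewrite ler_piMr ?expR_ge0// expR_le1 oppr_le0 divr_ge0// exprn_ge0.
Qed.

(** The numerator bounds [phi] from below on [[1 - beta, 2 - beta]], where [|y| <= beta + 2]; the
    denominator comes from [6 s + 1 <= (7 + beta) s]. *)
Definition gap_constant (beta : R) : R := expR (- ((beta + 2) ^+ 2 / 2)) / (7 + beta).

(** Here [y + beta >= 1], so [G y / phi y] is at most [exp (- 1 / (6 s)) <= 1 / (1 + 1 / (6 s))],
    and 1 minus the latter is [1 / (6 s + 1)]. *)
Lemma kernel_gap (y : R) : 1 <= (1 + beta) * s -> 1 - beta <= y <= 2 - beta ->
  gap_constant beta / s <= phi y - G y.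
Proof.
move=> s_ge /andP[y1 y2].
have yb : - beta <= y by lra.
have w1 : 1 <= (y + beta) ^+ 3 by apply: exprn_ege1; lra.
have [b0 s0] := (beta_gt0, s_gt0); have s6 : 0 < 6 * s by lra.
have G_le : G y <= phi y * (1 + (6 * s)^-1)^-1.
  apply: le_trans (erlang_kernel_le _ yb) _; rewrite ler_pM2l ?expR_gt0//.
  rewrite expRN lef_pV2 ?posrE ?expR_gt0//; last by rewrite addr_gt0// invr_gt0.
  apply: le_trans (expR_ge1Dx _); rewrite lerD2l -[leLHS]mul1r.
  by rewrite ler_pM2r// invr_gt0.
have -> : gap_constant beta / s =
    expR (- ((beta + 2) ^+ 2 / 2)) * ((7 + beta) * s)^-1.
  by rewrite /gap_constant invfM mulrA.
have phi_ge : expR (- ((beta + 2) ^+ 2 / 2)) <= phi y by rewrite ler_expR; nra.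
apply: (@le_trans _ _ (phi y * (6 * s + 1)^-1)).
  apply: ler_pM => //; rewrite ?expR_ge0 ?invr_ge0 ?mulr_ge0//; try lra.
  have s61 : 0 < 6 * s + 1 by lra.
  have s7 : 0 < (7 + beta) * s by apply: mulr_gt0 => //; lra.
  by rewrite lef_pV2 ?posrE//; nra.
have -> : phi y * (6 * s + 1)^-1 = phi y - phi y * (1 + (6 * s)^-1)^-1.
  have s61 : 6 * s + 1 != 0 by apply: lt0r_neq0; lra.
  by field; rewrite (lt0r_neq0 s0) s61.
by rewrite lerD2l lerN2.
Qed.

(** After reflection, [phi] is split as [G + (phi - G)]. The first term integrates exactly; the
    second is nonnegative and is kept only on an interval of length 1. *)
Lemma gauss_left_ge : 1 <= (1 + beta) * s ->
  ((a * (erlang_sum (s ^+ 2) m / s) + gap_constant beta / s)%:E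
   <= gauss_left beta)%E.
Proof.
move=> s_ge; have [b0 s0] := (beta_gt0, s_gt0).
have phiE : gauss_left beta =
    (\int[lebesgue_measure]_(y in `[(- beta)%R, +oo[) (phi y)%:E)%E.
  rewrite /gauss_left -{1}[beta]opprK ge0_integration_by_substitutionNy//.
  - by apply: eq_integral => y _ /=; rewrite sqrrN.
  - exact/continuous_subspaceT/continuous_gauss.
have mGphi (D : set R) : measurable_fun D (fun y => (phi y - G y)%:E).
  apply/measurable_EFinP/measurable_funTS; apply: continuous_measurable_fun => y.
  by apply: cvgB; [exact: continuous_gauss|exact: continuous_scaled_kernel].
have mG (D : set R) : measurable_fun D (fun y => (G y)%:E).
  apply/measurable_EFinP/measurable_funTS; apply: continuous_measurable_fun.
  exact: continuous_scaled_kernel.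
have -> : gauss_left beta =
    (\int[lebesgue_measure]_(y in `[(- beta)%R, +oo[) (G y)%:E +
     \int[lebesgue_measure]_(y in `[(- beta)%R, +oo[) (phi y - G y)%:E)%E.
  rewrite phiE -ge0_integralD//=.
  - by apply: eq_integral => y _; rewrite -EFinD subrKC.
  - by move=> y _; rewrite lee_fin mulr_ge0 ?expR_ge0.
  - exact: mG.
  - move=> y /=; rewrite in_itv/= andbT => /scaled_kernel_le_gauss.
    by rewrite lee_fin subr_ge0.
  - exact: mGphi.
rewrite EFinD; apply: leeD.
  under eq_integral do rewrite EFinM.
  rewrite ge0_integralZl_EFin ?expR_ge0//.
  - by rewrite integral_erlang_kernel// EFinM.
  - by move=> y _; rewrite lee_fin expR_ge0.
  - apply/measurable_EFinP/measurable_funTS; apply: continuous_measurable_fun => y.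
    apply: (@continuous_comp _ _ _ (fun y => y + beta) (erlang_kernel s m.+1)).
      by apply: cvgD; [exact: cvg_id|exact: cvg_cst].
    exact: continuous_erlang_kernel.
apply: (@le_trans _ _ (\int[lebesgue_measure]_(y in `[(1 - beta)%R, (2 - beta)%R])
    (phi y - G y)%:E)%E); last first.
  apply: ge0_subset_integral => //=; first exact: mGphi.
    move=> y /=; rewrite in_itv/= andbT => /scaled_kernel_le_gauss.
    by rewrite lee_fin subr_ge0.
  apply: subset_itv; rewrite bnd_simp//; lra.
apply: (@le_trans _ _ (\int[lebesgue_measure]_(y in `[(1 - beta)%R, (2 - beta)%R])
    (gap_constant beta / s)%:E)%E); last first.
  apply: ge0_le_integral => //=.
  - by move=> y _; rewrite lee_fin !divr_ge0 ?expR_ge0//; lra.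
  - exact: mGphi.
  - by move=> y /=; rewrite in_itv/= => yI; rewrite lee_fin kernel_gap.
rewrite integral_cst//= lebesgue_measure_itv/= lte_fin ltrD2r ltr1n -EFinB -EFinM.
by rewrite lee_fin; lra.
Qed.

End kernel_comparison.

(** * From the gap between the integrals to the gap between the means *)

Theorem proposition1 (R : realType) (beta : R) (beta_gt0 : 0 < beta) :
  exists C : R, 0 < C /\
    forall (lambda mu : R) (n : nat),
      0 < lambda -> 0 < mu -> (0 < n)%N ->
      n%:R = lambda / mu + beta * Num.sqrt (lambda / mu) ->
    forall (dX : measure_display) (TX : measurableType dX)
      (PX : probability TX R) (X : R -> {RV PX >-> nat})
      (Pt : R -> nat -> nat -> R) (pi : probability nat R),
      erlangC_chain lambda mu n Pt X -> stationary Pt pi ->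
    forall (dW : measure_display) (TW : measurableType dW)
      (PW : probability TW R) (W : {RV PW >-> R}),
      has_law W (pushforward pi (scaled_state (lambda / mu))) ->
    forall (dY : measure_display) (TY : measurableType dY)
      (PY : probability TY R) (Y0 : {RV PY >-> R}) (kappa : R),
      normalizing_constant mu beta kappa ->
      has_law Y0 (fun A => (\int[@lebesgue_measure R]_(x in A)
                             (diffusion_density mu beta kappa x)%:E)%E) ->
    ((C / Num.sqrt (lambda / mu))%:E <= `| 'E_PW[W] - 'E_PY[Y0] |)%E.
Proof.
(* [fine] would return 0 on an infinite value; [gl_fin] below excludes that case. *)
pose a : R := expR (- (beta ^+ 2 / 2)); pose B : R := fine (gauss_left beta).
pose Z : R := B / a + beta^-1.
have a_gt0 : 0 < a by exact: expR_gt0.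
have B_ge0 : 0 <= B.
  by apply/fine_ge0/integral_ge0 => x _; rewrite lee_fin expR_ge0.
have Z_gt0 : 0 < Z by rewrite ltr_wpDl ?invr_gt0// divr_ge0// ltW.
have gap_gt0 : 0 < gap_constant beta by rewrite divr_gt0 ?expR_gt0//; lra.
(* Chosen so that [C / s] is the bound [gap_constant beta / (s * a)] on [Z - Y] divided by
   [beta^2 Z^2], where [E W = 1 / (beta^2 Y)] and [E Y0 = 1 / (beta^2 Z)]. *)
exists (gap_constant beta / (a * beta ^+ 2 * Z ^+ 2)); split.
  by rewrite divr_gt0// !mulr_gt0// exprn_gt0.
move=> lambda mu [//|m] lambda_gt0 mu_gt0 _ nE dX TX PX X Pt pi [tf rates _] st
  dW TW PW W lawW dY TY PY Y0 kappa [kappa_gt0 kappaE] lawY.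
set r := lambda / mu in nE lawW *; pose s := Num.sqrt r.
have r_gt0 : 0 < r by rewrite divr_gt0.
have s_gt0 : 0 < s by rewrite sqrtr_gt0.
have rE : r = s ^+ 2 by rewrite sqr_sqrtr// ltW.
rewrite -/s in nE *.
(* From [1 <= n = s^2 + beta s]: if [s <= 1] then [s^2 <= s]; if [s > 1] the bound is immediate. *)
have s_ge : 1 <= (1 + beta) * s.
  have : 1 <= m.+1%:R :> R by rewrite ler1n.
  rewrite nE rE => s1; have [s_le|s_lt] := leP s 1; nra.
pose p k := fine (pi [set k]).
have balance k : r * p k = (minn k.+1 m.+1)%:R * p k.+1.
  have := erlangC_detailed_balance pi tf rates st _ _ _ erefl k (ltW mu_gt0).
  move=> e; apply: (mulfI (lt0r_neq0 mu_gt0)).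
  rewrite [RHS]mulrA -e mulrA; congr (_ * _).
  by rewrite /r mulrC divfK// lt0r_neq0.
have r_lt : r < m.+1%:R by rewrite nE ltrDl mulr_gt0.
have mass := mass_total r m p r_gt0 r_lt balance (probability_nat_series _ pi).
have nr : m.+1%:R - r = beta * s by rewrite nE addrAC subrr add0r.
have EW : ('E_PW[W] = (s * p m / beta ^+ 2)%:E)%E.
  rewrite (expectation_has_law _ _ _ _ _ _ pi _ _ _ lawW)//.
  apply: (integral_nat_eventually_ge0 _ pi _ m.+1) => [k km|].
    rewrite /scaled_state mulr_ge0 ?invr_ge0 ?(ltW s_gt0)// subr_ge0 ltW//.
    by rewrite (lt_le_trans r_lt)// ler_nat.
  have := mean_total r m p r_gt0 r_lt (fun k => fine_ge0 (measure_ge0 _ _)) balance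
    (probability_nat_series _ pi).
  rewrite nr => /(cvgMl_tmp (a := s^-1)).
  have -> : s^-1 * ((r / (beta * s)) ^+ 2 * p m) = s * p m / beta ^+ 2.
    by rewrite rE; field; rewrite !lt0r_neq0.
  move=> cv; rewrite (_ : series _ =
      (fun N => s^-1 * series (fun k => (k%:R - r) * p k) N))//.
  apply/funext => N; rewrite /series/= mulr_sumr.
  by apply: eq_bigr => k _; rewrite mulrA.
pose S := erlang_sum r m; pose Y := S / s + beta^-1.
have S_ge0 : 0 <= S by exact/erlang_sum_ge0/ltW.
have Y_gt0 : 0 < Y by rewrite ltr_wpDl ?invr_gt0// divr_ge0// ltW.
have pE : s * p m = Y^-1.
  apply: (mulIf (lt0r_neq0 Y_gt0)); rewrite mulVf ?lt0r_neq0// -mass nr /Y -/S rE.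
  by field; rewrite !lt0r_neq0.
(* An infinite [gauss_left] would make the total mass infinite, since [kappa / mu > 0]; with a
   finite one, total mass 1 determines [kappa]. *)
have [gl_fin kappaZ] : gauss_left beta \is a fin_num /\ kappa / mu * a = Z^-1.
  have densE x : diffusion_density mu beta kappa x =
      kappa / mu * expR (drift_potential beta x).
    by rewrite /diffusion_density integral_from0_drift.
  have [k0 gl0] : 0 < kappa / mu /\ (0 <= gauss_left beta)%E.
    split; first exact: divr_gt0.
    by apply: integral_ge0 => x _; rewrite lee_fin expR_ge0.
  move: kappaE; under eq_integral do rewrite densE EFinM.
  rewrite ge0_integralZl_EFin//; last 2 first.
  - apply/measurable_EFinP; apply: continuous_measurable_fun.
    exact: continuous_expR_drift_potential.
  - exact: ltW.
  rewrite integral_expR_potential// -/a => mass_Y.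
  have [gl_fin e] : gauss_left beta \is a fin_num /\
      kappa / mu * (B + a / beta) = 1.
    rewrite /B; case: (gauss_left beta) gl0 mass_Y => [b _|_|//].
      by rewrite -EFinD -EFinM => -[].
    by rewrite addye// gt0_muley// lte_fin.
  split=> //; apply: (mulIf (lt0r_neq0 Z_gt0)); rewrite mulVf ?lt0r_neq0// -e /Z.
  by field; rewrite !lt0r_neq0.
have EY : ('E_PY[Y0] = (Z^-1 / beta ^+ 2)%:E)%E.
  by rewrite (expectation_diffusion _ _ _ _ _ _ _ _ mu_gt0 beta_gt0 (ltW kappa_gt0) lawY)
    -kappaZ mulrA.
have gap : gap_constant beta / (s * a) <= Z - Y.
  have mE : m.+1%:R = s ^+ 2 + beta * s by rewrite nE rE.
  have := gauss_left_ge beta s m beta_gt0 s_gt0 mE s_ge.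
  have [b gb] : exists b, gauss_left beta = b%:E.
    by exists B; rewrite fineK// gl_fin.
  rewrite /Z /B gb lee_fin -rE -/S -/a /= => le_b.
  rewrite -(ler_pM2r a_gt0).
  have -> : gap_constant beta / (s * a) * a = gap_constant beta / s.
    by field; rewrite !lt0r_neq0.
  have -> : (b / a + beta^-1 - Y) * a = b - a * (S / s).
    by rewrite /Y; field; rewrite !lt0r_neq0.
  by rewrite lerBrDl.
rewrite EW EY pE -EFinB abse_EFin lee_fin.
apply: le_trans (ler_norm _).
have -> : Y^-1 / beta ^+ 2 - Z^-1 / beta ^+ 2 = (Z - Y) / (Y * Z * beta ^+ 2).
  by field; rewrite !lt0r_neq0.
have -> : gap_constant beta / (a * beta ^+ 2 * Z ^+ 2) / s =
    gap_constant beta / (s * a) / (Z * Z * beta ^+ 2).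
  by field; rewrite !lt0r_neq0.
have gap0 : 0 <= gap_constant beta / (s * a).
  by rewrite ltW// divr_gt0// mulr_gt0.
have YZ_gt0 : 0 < Y * Z * beta ^+ 2 by rewrite !mulr_gt0 ?exprn_gt0.
have ZZ_gt0 : 0 < Z * Z * beta ^+ 2 by rewrite !mulr_gt0 ?exprn_gt0.
apply: ler_pM; [by []|by rewrite invr_ge0 ltW|by []|].
rewrite lef_pV2 ?posrE//.
(* Enlarging [Y] to [Z] in the denominator is legitimate because the gap already gives [Y <= Z]. *)
rewrite ler_pM2r ?exprn_gt0// ler_pM2r// -subr_ge0.
exact: le_trans gap0 gap.
Qed.
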